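(* Let $r>1$ and let $\mu=h\lambda$ be a Borel probability measure on $\mathbb{R}$ with weakly unimodal Lebesgue density $h$ and $\int|x|^r\,d\mu(x)<\infty$. Let $(q_n)_{n\in\mathbb{N}}$ be the sequence of $n$-level Gersho quantizers of order $r$ for $\mu$. If $$C_0 = 2^{-r}(1+r)^{-1}\left(\int h^{1/(1+r)}\,d\lambda\right)^{1+r}<\infty,$$ then $(q_n)_{n\in\mathbb{N}}$ is asymptotically optimal, i.e. $\operatorname{card}(q_n(\mathbb{R}))\le n$ for all $n$ and $$n^r D(\mu,q_n,r)\to C_0\qquad\text{as } n\to\infty.$$
   Context: $\lambda$ is Lebesgue measure on $\mathbb{R}$. A probability density $h$ is weakly unimodal if $h$ is continuous on its support and there exists $l_0>0$ such that $\{x: h(x)\ge l\}$ is a compact interval for every $l\in(0,l_0)$. Then the support of $\mu=h\lambda$ is a (possibly unbounded) interval. A quantizer is a Borel-measurable map $q:\mathbb{R}\to\mathbb{R}$ with countable (finite or countably infinite) image. Its distortion is $D(\mu,q,r)=\int |x-q(x)|^r\,d\mu(x)$. The set $q^{-1}(a)$ is the codecell of $a\in q(\mathbb{R})$. For Borel $A$ with $\mu(A)>0$, $\mu(\cdot|A)$ is the conditional probability. A quantizer $q$ is an $n$-level Gersho quantizer of order $r$ for $\mu$ if (G1) $\operatorname{card}(q(\mathbb{R}))=n$; (G2) $q^{-1}(a)$ is an interval for every $a\in q(\mathbb{R})$; (G3) every $a\in q(\mathbb{R})$ is optimal for its own codecell, i.e. $\int |x-a|^r\,d\mu(x|q^{-1}(a))=\inf_{b\in\mathbb{R}}\int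 |x-b|^r\,d\mu(x|q^{-1}(a))$; (G4) $\int_{q^{-1}(a)}|x-a|^r\,d\mu(x)=\frac1n D(\mu,q,r)$ for every $a\in q(\mathbb{R})$. (Since $\mu$ is non-atomic, all codecells then have positive $\mu$-mass.) Convention: the codecells $I_1,\dots,I_n$ of a Gersho quantizer, listed in increasing order, are always taken in the normalized form $I_1=(a_1,b_1)$ and $I_i=[a_i,b_i)$ for $i\in\{2,\dots,n\}$, where $a_1=-\infty$, $b_n=\infty$ and $a_i=b_{i-1}$ for $i\in\{2,\dots,n\}$. With this convention, for $r>1$ and $\mu$ with interval support there is exactly one $n$-level Gersho quantizer of order $r$ for each $n\in\mathbb{N}$; it is denoted $q_n$. *)

(* Defs.v *)
From HB Require Import structures.
From mathcomp Require Import all_boot all_order all_algebra.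
From mathcomp Require Import all_classical all_reals all_analysis.

Set Implicit Arguments.
Unset Strict Implicit.
Unset Printing Implicit Defensive.

Import Order.TTheory GRing.Theory Num.Theory.
Import numFieldNormedType.Exports.

Local Open Scope classical_set_scope.
Local Open Scope ring_scope.

(* [mu = h lambda] for a (finite-valued, everywhere defined) density [h];
   [\int h = 1] follows from [mu] being a probability. *)
Definition is_lebesgue_density (R : realType)
    (mu : probability (measurableTypeR R) R) (h : R -> R) : Prop :=
  [/\ measurable_fun [set: measurableTypeR R] (h : measurableTypeR R -> R),
      (forall x, 0 <= h x)
    & forall A : set (measurableTypeR R), measurable A ->
        mu A = (\int[lebesgue_measure]_(x in A) (h x)%:E)%E].

Definition density_support (R : realType) (h : R -> R) : set R :=
  closure [set x | h x != 0].

Definition weakly_unimodal (R : realType) (h : R -> R) : Prop :=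
  {within density_support h, continuous h} /\
  exists l0 : R, 0 < l0 /\
    forall l : R, 0 < l < l0 ->
      exists a b : R, a <= b /\ [set x | l <= h x] = [set` `[a, b]].

Definition quantizer (R : realType) (q : R -> R) : Prop :=
  measurable_fun [set: measurableTypeR R]
    (q : measurableTypeR R -> measurableTypeR R) /\
  countable (range q).

Definition distortion (R : realType)
    (mu : probability (measurableTypeR R) R) (q : R -> R) (r : R) : \bar R :=
  (\int[mu]_x (`|x - q x| `^ r)%:E)%E.

Definition codecell (R : realType) (q : R -> R) (a : R) :
    set (measurableTypeR R) :=
  q @^-1` [set a].

(* [mu(.|A)]; [mnormalize] requires a default value for the case [mu A = 0],
   which cannot occur for a codecell of a Gersho quantizer of a non-atomic
   [mu]. *)
Definition cond_prob (R : realType) (mu : probability (measurableTypeR R) R)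
    (A : set (measurableTypeR R)) (mA : measurable A) :
    probability (measurableTypeR R) R :=
  mnormalize (mrestr mu mA) mu.

Definition optimal_point (R : realType)
    (P : probability (measurableTypeR R) R) (r a : R) : Prop :=
  (\int[P]_x (`|x - a| `^ r)%:E)%E =
  ereal_inf (range (fun b : R => (\int[P]_x (`|x - b| `^ r)%:E)%E)).

(* The premise [mA] is automatic: codecells of a quantizer are Borel. *)
Definition gersho (R : realType) (mu : probability (measurableTypeR R) R)
    (r : R) (n : nat) (q : R -> R) : Prop :=
  quantizer q /\
  [/\ (range q #= `I_n)%card,
      (forall a, range q a -> is_interval (codecell q a : set R)),
      (forall a (mA : measurable (codecell q a)), range q a ->
         optimal_point (cond_prob mu mA) r a)
    & (forall a, range q a ->
         (\int[mu]_(x in codecell q a) (`|x - a| `^ r)%:E)%E =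
         ((n%:R^-1)%:E * distortion mu q r)%E)].

(* The codecells are exactly [I_i = [t_(i-1), t_i)], 1 <= i <= n, with
   [t_0 = -oo] and [t_n = +oo]; as [x] is real, [I_1] is [(-oo, t_1)]. *)
Definition normalized_cells (R : realType) (n : nat) (q : R -> R) : Prop :=
  exists t : nat -> \bar R,
    [/\ t 0%N = -oo%E, t n = +oo%E,
        (forall i, (i < n)%N -> (t i < t i.+1)%E)
      & [set codecell q a | a in range q] =
        [set [set x : measurableTypeR R | (t i <= x%:E < t i.+1)%E]
          | i in `I_n]].

Definition gersho_sequence (R : realType)
    (mu : probability (measurableTypeR R) R) (r : R) (q : nat -> R -> R) :
    Prop :=
  forall n, (0 < n)%N -> gersho mu r n (q n) /\ normalized_cells n (q n).

Definition C0 (R : realType) (h : R -> R) (r : R) : \bar R :=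
  ((2 `^ (- r) * (1 + r)^-1)%:E *
   (\int[lebesgue_measure]_(x in [set: measurableTypeR R])
      (h x `^ (1 / (1 + r)))%:E) `^ (1 + r))%E.

Definition asymptotically_optimal (R : realType)
    (mu : probability (measurableTypeR R) R) (h : R -> R) (r : R)
    (q : nat -> R -> R) : Prop :=
  (forall n, (0 < n)%N -> (range (q n) #<= `I_n)%card) /\
  ((n%:R `^ r)%:E * distortion mu (q n) r)%E @[n --> \oo] --> C0 h r.

(* Main.v *)
Require Import Defs.
From mathcomp Require Import all_boot all_order all_algebra.
From mathcomp Require Import all_classical all_reals all_analysis.
From mathcomp Require Import measurable_realfun ring lra.

Import Order.TTheory GRing.Theory Num.Theory.
Import numFieldNormedType.Exports.

Local Open Scope classical_set_scope.
Local Open Scope ring_scope.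

(** Write [g = h^(1/(1+r))], [J] for its Lebesgue integral, and
[Q = 2^(-r) / (1+r)], so that the limit to be found is [Q * J^(1+r)].
An interval of length [L] carrying the constant density [h] has distortion
[Q * h * L^(1+r) = Q * (g * L)^(1+r)] about its midpoint. This suggests writing
the common distortion of the [n] cells of [q_n] as [Q * e^(1+r)]: the size [e]
of a cell then plays the role of the integral of [g] over it. Since
[n^r * D(mu, q_n, r) = n^(1+r) * Q * e^(1+r) = Q * (n * e)^(1+r)], it suffices to
prove that [n * e] tends to [J], that is, that the sum of the sizes of the cells
approaches the integral of [g].

Comparing with the constant quantizer 0 gives [n * Q * e^(1+r) <= int |x|^r dmu],
so [e] tends to 0. Fix a level [l < l0], so that all the level sets [{h >= l'}] with
[0 < l' <= l] are compact intervals, and put [K = {h >= l} = [A, B]]. As [h >= l] on [K], the trace of a cell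
on [K] has length at most [e / l^(1/(1+r))], and [g], being uniformly
continuous on [K], oscillates by at most [eps] on that trace once [n] is large.

- Lower bound. By [integral_dist_powR_ge] no point serves a set better than the
  midpoint serves an interval of the same length. Hence the integral of [g] over
  the trace of a cell on [K] exceeds the size of the cell by at most [2 * eps] per
  unit of length ([integral_root_density_le]), and summing gives
  [int_K g <= n * e + 2 * eps * (B - A)] ([integral_level_le]).

- Upper bound. A cell inside [K] is no worse served by its code point than by its
  midpoint, so its size is at most the integral of [g + 2 * eps] over it
  ([le_integral_root_density]). At most two cells contain [A] or [B], and they
  contribute at most [2 * e]. On each remaining cell [h] is monotone, and
  the size is bounded by a constant times the integral of [g] over the cell:
  if [h] is nondecreasing and the cell has supremum [b], then
  [(b - x) * g x <= int_cell g =: G], so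
  [(b - x)^r * h x = ((b - x) * g x)^r * g x <= G^r * g x], and integration
  gives a distortion of at most [G^(1+r)] about [b]. This is where unimodality
  enters; the cells outside [K] together cost at most a constant times the
  integral of [g] outside [K] ([le_integral_level]).

Since [J] is finite and the sets [{h >= l}] exhaust [{h > 0}] as [l] decreases
to 0, the integral of [g] outside [K] can be made small first, and then [eps] and
[e] ([normalized_cell_size_cvg]). *)

(** * Real powers and the moment of an interval about its midpoint *)

Section power.
Set Implicit Arguments.
Unset Strict Implicit.
Context {R : realType}.
Implicit Types (x y a d r s : R).

Lemma powRrV x s : 0 <= x -> s != 0 -> (x `^ s) `^ (1 / s) = x.
Proof. by move=> x0 s0; rewrite -powRrM div1r divff// powRr1. Qed.

Lemma powRVr x s : 0 <= x -> s != 0 -> (x `^ (1 / s)) `^ s = x.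
Proof. by move=> x0 s0; rewrite powRAC powRrV. Qed.

Lemma ler_powR_inv s x y : 0 < s -> 0 <= y -> x `^ s <= y `^ s -> x <= y.
Proof.
move=> s0 y0; case: (ltP x 0) => [/ltW x0 _|x0]; first exact: le_trans y0.
by rewrite leNgt => /negP h; rewrite leNgt; apply/negP => yx; apply: h; exact: gt0_ltr_powR.
Qed.

Lemma ler_powRl s x y : 0 <= s -> 0 <= x -> x <= y -> x `^ s <= y `^ s.
Proof.
by move=> s0 x0 xy; apply: ge0_ler_powR; rewrite ?nnegrE// (le_trans x0).
Qed.

Lemma powRS x s : 0 <= x -> 0 < s -> x `^ (1 + s) = x * x `^ s.
Proof.
move=> x0 s0; rewrite powRD; first by rewrite powRr1.
by rewrite gt_eqF// addr_gt0.
Qed.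

(** The absolute value matters: [powR] takes the value 1 at negative numbers, so
without it the function would jump at 0. *)
Lemma continuous_norm_powR s : 0 < s -> continuous (fun x => `|x| `^ s : R).
Proof.
move=> s0 x; have [->|x0] := eqVneq x 0; last first.
  apply: (@continuous_comp _ _ _ (fun x : R => `|x|) (fun y : R => y `^ s)).
    exact: norm_continuous.
  apply: differentiable_continuous; apply/derivable1_diffP.
  by apply: derivable_powR; rewrite in_itv/= andbT normr_gt0.
apply/cvgrPdist_lt => e e0; rewrite normr0 powR0 ?gt_eqF//.
near=> y; rewrite sub0r normrN ger0_norm ?powR_ge0//.
rewrite -(@powRVr e s) ?ltW// ?gt_eqF//.
rewrite gt0_ltr_powR// ?nnegrE ?powR_ge0//.
near: y; apply: (@nbhs0_lt R R); exact: powR_gt0.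
Unshelve. all: by end_near. Qed.

(** The primitive [x * |x|^r] of [(1 + r) * |x|^r] is differentiable on the whole
line, so a moment about an interior point needs no splitting at that point. *)
Lemma is_derive_mul_norm_powR r x : 0 < r ->
  is_derive x 1 (fun x => x * `|x| `^ r : R) ((1 + r) * `|x| `^ r).
Proof.
move=> r0.
have pos y : 0 < y -> is_derive y 1 (fun x => x * `|x| `^ r : R) ((1 + r) * `|y| `^ r).
  move=> y0; apply: (@near_eq_is_derive _ _ _ (fun z => z `^ (1 + r))).
    near=> z; have z0 : 0 < z by near: z; exact: lt_nbhsr.
    by rewrite powRS// ?(ltW z0)// ger0_norm// ltW.
  apply: (is_derive_eq (is_derive1_powR (1 + r) y0)).
  by rewrite ger0_norm ?(ltW y0)//; congr (_ * _ `^ _); rewrite addrAC subrr add0r.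
have [x0|/pos//|->] := ltgtP x 0; last first.
  (* at 0 the difference quotient is [|z|^r] itself *)
  apply/is_derive1_caratheodory; exists (fun z => `|z| `^ r); split.
  - by move=> z; rewrite mul0r !subr0 mulrC.
  - exact: continuous_norm_powR.
  - by rewrite normr0 powR0 ?mulr0// gt_eqF.
have /pos dG : 0 < - x by rewrite oppr_gt0.
have dN : is_derive x 1 (-%R : R -> R) (- 1) by exact: is_deriveN.
have /is_deriveN dF := @is_derive1_comp _ _ _ _ _ _ dG dN.
apply: (near_eq_is_derive _ (is_derive_eq dF _)).
  by near=> z; rewrite !fctE/= normrN mulNr opprK.
by rewrite normrN mulrN1 opprK.
Unshelve. all: by end_near. Qed.

(** The constant [2^(-r) / (1+r)] of the asymptotic formula: it is the distortion
of the uniform density on an interval of length 1 about its midpoint. *)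
Lemma integral_centered_power r a L : 0 < r -> 0 <= L ->
  (\int[lebesgue_measure]_(x in `[(a - L / 2)%R, (a + L / 2)%R]) (`|x - a| `^ r)%:E
   = ((2 `^ (- r) * (1 + r)^-1) * L `^ (1 + r))%:E)%E.
Proof.
move=> r0; rewrite le_eqVlt => /predU1P[<-|L0].
  rewrite mul0r subr0 addr0 set_itv1 integral_set1 powR0 ?mulr0//.
  by rewrite gt_eqF// addr_gt0.
have -> : L = 2 * (L / 2) by field.
have : 0 < L / 2 by rewrite divr_gt0.
move: (L / 2) => d d0; rewrite [2 * d]mulrC mulfK//.
have r1 : 1 + r != 0 by rewrite gt_eqF// addr_gt0.
pose G x := (1 + r)^-1 * ((x - a) * `|x - a| `^ r).
have dG x : is_derive x 1 G (`|x - a| `^ r).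
  have dH := @is_derive_mul_norm_powR r (x - a) r0.
  have dT : is_derive x 1 (shift (- a) : R -> R) 1 := is_derive_shift _ _ _.
  have dC := @is_derive1_comp _ _ (center a : R -> R) x _ _ dH dT.
  have := is_deriveZ (1 + r)^-1 dC.
  by move/is_derive_eq; apply; rewrite mulr1 /GRing.scale/= mulKf.
have cG : continuous G.
  by move=> x; apply: differentiable_continuous; apply/derivable1_diffP; apply: ex_derive.
rewrite (@continuous_FTC2 _ _ G)//.
- rewrite -EFinB /G; congr EFin.
  rewrite (addrC a) addrK (addrC a) addrK normrN ger0_norm ?ltW//.
  have p2 := @powR_gt0 R 2 r ltac:(by []).
  rewrite powRM ?ltW// powRN !powRS ?ltW//.
  by field; rewrite r1 gt_eqF.
- lra.
- apply: continuous_subspaceT => x.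
  apply: (@continuous_comp _ _ _ (fun x : R => x - a) (fun y : R => `|y| `^ r)).
    by apply: continuousB => //; exact: cvg_cst.
  exact: continuous_norm_powR.
- split => //.
  + by apply: cvg_at_right_filter; exact: cG.
  + by apply: cvg_at_left_filter; exact: cG.
- by move=> x _; rewrite derive1E; apply: derive_val.
Qed.
End power.

(** * Integration against a density, and the bathtub inequality *)

Section density.
Set Implicit Arguments.
Unset Strict Implicit.
Context {R : realType}.
Local Notation leb := (@lebesgue_measure R).
Local Open Scope ereal_scope.

(** By uniqueness, [h] agrees almost everywhere with the Radon-Nikodym derivative of
[mu], for which the change of measure is known. *)
Lemma integral_density (mu : probability (measurableTypeR R) R) (h : R -> R)
    (D : set (measurableTypeR R)) (f : measurableTypeR R -> \bar R) :
  is_lebesgue_density mu h -> measurable D -> measurable_fun D f ->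
  (forall x, 0 <= f x) ->
  \int[mu]_(x in D) f x = \int[leb]_(x in D) (f x * (h x)%:E).
Proof.
move=> [mh h0 muE] mD mf f0.
have dom : mu `<< leb.
  apply/null_content_dominatesP => A mA A0; rewrite muE//.
  transitivity (\int[leb]_(x in A) cst 0 x); last by rewrite integral0.
  apply: ae_eq_integral => //; last exact: ae_eq0.
  exact/measurable_EFinP/measurable_funTS.
rewrite -(Radon_Nikodym_SigmaFinite.change_of_variables dom)//.
have intd := Radon_Nikodym_SigmaFinite.f_integrable dom.
apply: ae_eq_integral => //.
- apply: emeasurable_funM => //; apply: (measurable_int leb).
  exact: (integrableS _ _ (@subsetT _ _)).
- apply: emeasurable_funM => //; exact/measurable_EFinP/measurable_funTS.
- apply: ae_eqe_mul2l; apply: integral_ae_eq => //.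
  + exact: integrableS intd.
  + exact/measurable_EFinP/measurable_funTS.
  + move=> E ED mE; transitivity (mu E); last exact: muE.
    exact/esym/(Radon_Nikodym_SigmaFinite.f_integral dom).
Qed.

Lemma integral_cst_lebesgue (B : set (measurableTypeR R)) (k L : R) :
  measurable B -> leb B = L%:E ->
  \int[leb]_(x in B) (cst k%:E) x = (k * L)%:E.
Proof. by move=> mB BL; rewrite integral_cst// EFinM -BL. Qed.

Lemma measurable_dist_powR (D : set (measurableTypeR R)) (a r : R) :
  measurable_fun D (fun x : measurableTypeR R => (`|x - a| `^ r)%:E).
Proof.
apply/measurable_EFinP; apply: measurable_funTS.
have m1 : measurable_fun [set: measurableTypeR R] (fun x : measurableTypeR R => x - a : R)%R.
  exact: measurable_funB.
have m2 : measurable_fun [set: measurableTypeR R] (fun x : measurableTypeR R => `|x - a| : R)%R.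
  exact: measurableT_comp.
exact: (measurableT_comp (measurable_powR _) m2).
Qed.

(** Bathtub principle: among the sets of measure [L], the interval [K] of
length [L] centred at [a] has the least moment about [a]. Indeed
[|x - a|^r - (L/2)^r] is nonpositive on [K] and nonnegative off [K]. *)
Lemma integral_dist_powR_ge (B : set (measurableTypeR R)) (a r L : R) :
  (0 < r)%R -> measurable B -> leb B = L%:E ->
  ((2 `^ (- r) * (1 + r)^-1) * L `^ (1 + r))%:E <=
  \int[leb]_(x in B) (`|x - a| `^ r)%:E.
Proof.
move=> r0 mB BL.
have L0 : (0 <= L)%R by rewrite -lee_fin -BL.
pose d := (L / 2)%R; have d0 : (0 <= d)%R by rewrite divr_ge0.
rewrite -(@integral_centered_power R r a L r0 L0) -/d.
pose K : set (measurableTypeR R) := [set` `[(a - d)%R, (a + d)%R]].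
rewrite -/K; have mK : measurable K by exact: measurable_itv.
have KL : leb K = L%:E.
  rewrite /K lebesgue_measure_itv/= lte_fin.
  case: ltP => h; first by rewrite -EFinB /d; congr EFin; lra.
  by congr EFin; move: h d0; rewrite /d; lra.
set f := fun x : measurableTypeR R => (`|x - a| `^ r)%:E.
have f0 x : 0 <= f x by rewrite lee_fin powR_ge0.
(* Each side is the integral of a nonnegative function, so the pointwise inequality
   can be integrated before the two finite terms [d^r * leb _] are cancelled. *)
have key : \int[leb]_(x in K) f x + (d `^ r)%:E * leb B <=
           \int[leb]_(x in B) f x + (d `^ r)%:E * leb K.
  have sum A C : measurable A -> measurable C ->
      \int[leb]_(x in A) f x + (d `^ r)%:E * leb C =
      \int[leb]_x ((f \_ A) x + (cst (d `^ r)%:E \_ C) x).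
    move=> mA mC; rewrite -(integral_cst leb mC) !(integral_mkcond A) (integral_mkcond C).
    rewrite ge0_integralD//.
    - by move=> x _; exact: erestrict_ge0.
    - by apply/(measurable_restrictT _ mA); exact: measurable_dist_powR.
    - by move=> x _; apply: erestrict_ge0 => y _; rewrite lee_fin powR_ge0.
    - by apply/(measurable_restrictT _ mC); exact: measurable_cst.
  have mE A C : measurable A -> measurable C ->
      measurable_fun setT (fun x => (f \_ A) x + (cst (d `^ r)%:E \_ C) x).
    move=> mA mC; apply: emeasurable_funD.
      by apply/(measurable_restrictT _ mA); exact: measurable_dist_powR.
    by apply/(measurable_restrictT _ mC); exact: measurable_cst.
  rewrite !sum//; apply: ge0_le_integral => //.
  - move=> x _; apply: adde_ge0; apply: erestrict_ge0 => // y _.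
    by rewrite lee_fin powR_ge0.
  - exact: mE.
  - exact: mE.
  move=> x _; rewrite !patchE.
  have inK : (x \in K) = (`|x - a| <= d)%R.
    by rewrite ler_distl; apply/idP/idP => [/set_mem|h];
      [|apply/mem_set]; rewrite /K/= in_itv.
  rewrite inK; case: (leP `|x - a| d)%R => xd; case: ifP => _;
    rewrite ?adde0 ?add0e// ?lee_fin ?powR_ge0//.
    by apply: ler_powRl => //; exact: ltW.
  by apply: ler_powRl => //; exact: ltW.
move: key; rewrite BL KL -EFinM.
by rewrite leeD2rE.
Qed.
End density.

(** * Size of a cell under pointwise bounds on the density *)

Section cell.
Set Implicit Arguments.
Unset Strict Implicit.
Context {R : realType}.
Variables (r : R) (mu : probability (measurableTypeR R) R) (h : R -> R).
Hypotheses (r0 : 0 < r) (hdens : is_lebesgue_density mu h).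
Local Notation leb := (@lebesgue_measure R).
Local Notation Q := (2 `^ (- r) * (1 + r)^-1).
Local Notation g := (fun x => h x `^ (1 / (1 + r))).
Implicit Types F B : set (measurableTypeR R).

Let r1 : 0 < 1 + r. Proof. by rewrite addr_gt0. Qed.
Let r1n : 1 + r != 0. Proof. by rewrite gt_eqF. Qed.
Let h0 x : 0 <= h x. Proof. by case: hdens. Qed.
Let g0 x : 0 <= g x. Proof. exact: powR_ge0. Qed.

Let Q_gt0 : 0 < Q.
Proof. by rewrite mulr_gt0 ?invr_gt0// powR_gt0. Qed.

Let root_densityK x : (g x) `^ (1 + r) = h x.
Proof. exact: powRVr. Qed.

Lemma measurable_root_density F : measurable_fun F (fun x => (g x)%:E).
Proof.
case: hdens => mh _ _; apply/measurable_EFinP; apply: measurable_funTS.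
exact: (measurableT_comp (measurable_powR _) mh).
Qed.

Let dist0 (a x : R) : (0 <= (`|x - a| `^ r)%:E)%E.
Proof. by rewrite lee_fin powR_ge0. Qed.

(** Where [h >= u^(1+r)], the distortion about any point dominates [u^(1+r)] times
the Lebesgue moment, and the bathtub principle applies. In terms of the
size [e] of the cell the exponents disappear. *)
Lemma cell_size_ge F B (a e u L : R) :
  measurable F -> measurable B -> B `<=` F -> leb B = L%:E ->
  0 <= e -> 0 <= u -> (forall x, B x -> u <= g x) ->
  (\int[mu]_(x in F) (`|x - a| `^ r)%:E <= (Q * e `^ (1 + r))%:E)%E ->
  u * L <= e.
Proof.
move=> mF mB BF BL e0 u0 ug le_e.
have L0 : 0 <= L by rewrite -lee_fin -BL.
apply: (ler_powR_inv r1 e0); rewrite -(ler_pM2l Q_gt0) -lee_fin.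
apply: le_trans le_e.
apply: (@le_trans _ _ (\int[mu]_(x in B) (`|x - a| `^ r)%:E)%E); last first.
  by apply: ge0_subset_integral => //; exact: measurable_dist_powR.
rewrite (integral_density hdens)//; last exact: measurable_dist_powR.
apply: (@le_trans _ _ (\int[leb]_(x in B) ((u `^ (1 + r))%:E * (`|x - a| `^ r)%:E))%E).
  rewrite ge0_integralZl_EFin ?powR_ge0//; last exact: measurable_dist_powR.
  rewrite powRM// mulrCA EFinM lee_wpmul2l ?lee_fin ?powR_ge0//.
  exact: integral_dist_powR_ge.
apply: ge0_le_integral => //.
- by move=> x _; rewrite mule_ge0// lee_fin powR_ge0.
- by apply: measurable_funeM; exact: measurable_dist_powR.
- apply: emeasurable_funM; first exact: measurable_dist_powR.
  by apply/measurable_EFinP/measurable_funTS; case: hdens.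
- move=> x Bx; rewrite muleC lee_wpmul2l// lee_fin -root_densityK.
  by apply: ler_powRl => //; [exact: ltW|exact: ug].
Qed.

(** The matching upper bound: a cell that is an interval of length [L] with midpoint
[m] has at most the distortion about [m] of the constant density [v^(1+r)]. *)
Lemma cell_size_le F (m L e v : R) :
  measurable F -> 0 <= L -> F `<=` `[m - L / 2, m + L / 2] ->
  0 <= v -> (forall x, F x -> g x <= v) ->
  ((Q * e `^ (1 + r))%:E <= \int[mu]_(x in F) (`|x - m| `^ r)%:E)%E ->
  e <= v * L.
Proof.
move=> mF L0 FK v0 gv le_e.
apply: (ler_powR_inv r1); first by rewrite mulr_ge0.
rewrite -(ler_pM2l Q_gt0) -lee_fin; apply: (le_trans le_e).
rewrite (integral_density hdens)//; last exact: measurable_dist_powR.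
pose K : set (measurableTypeR R) := [set` `[m - L / 2, m + L / 2]].
have mK : measurable K by exact: measurable_itv.
apply: (@le_trans _ _ (\int[leb]_(x in F) ((v `^ (1 + r))%:E * (`|x - m| `^ r)%:E))%E).
  apply: ge0_le_integral => //.
  - by move=> x _; rewrite mule_ge0// lee_fin.
  - apply: emeasurable_funM; first exact: measurable_dist_powR.
    by apply/measurable_EFinP/measurable_funTS; case: hdens.
  - by apply: measurable_funeM; exact: measurable_dist_powR.
  - move=> x Fx; rewrite muleC lee_wpmul2r// lee_fin -root_densityK.
    by apply: ler_powRl => //; [exact: ltW|exact: gv].
rewrite ge0_integralZl_EFin ?powR_ge0//; last exact: measurable_dist_powR.
rewrite powRM// mulrCA EFinM lee_wpmul2l ?lee_fin ?powR_ge0//.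
apply: (@le_trans _ _ (\int[leb]_(x in K) (`|x - m| `^ r)%:E)%E).
  by apply: ge0_subset_integral => //; exact: measurable_dist_powR.
by rewrite /K integral_centered_power// divr_ge0.
Qed.

(** The identity [|x - b|^r * h x = (|x - b| * g x)^r * g x] reduces a bound of the
distortion by [G^(1+r)] to the pointwise bound of [|x - b| * g x] by [G]. The
length of the cell does not enter, so the two unbounded cells are covered. *)
Lemma cell_size_le_integral F (b e G : R) :
  measurable F -> 0 <= e -> (\int[leb]_(x in F) (g x)%:E = G%:E)%E ->
  (forall x, F x -> `|x - b| * g x <= G) ->
  ((Q * e `^ (1 + r))%:E <= \int[mu]_(x in F) (`|x - b| `^ r)%:E)%E ->
  Q `^ (1 / (1 + r)) * e <= G.
Proof.
move=> mF e0 FG gG le_e.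
have G0 : 0 <= G by rewrite -lee_fin -FG; apply: integral_ge0 => x _; rewrite lee_fin.
apply: (ler_powR_inv r1 G0); rewrite (@powRM _ (Q `^ _) e) ?powR_ge0//.
rewrite powRVr ?(ltW Q_gt0)//.
rewrite -lee_fin; apply: (le_trans le_e).
rewrite (integral_density hdens)//; last exact: measurable_dist_powR.
rewrite powRS// mulrC EFinM -FG -ge0_integralZl_EFin ?powR_ge0//; last first.
- exact: measurable_root_density.
- by move=> x _; rewrite lee_fin.
apply: ge0_le_integral => //.
- by move=> x _; rewrite mule_ge0// lee_fin.
- apply: emeasurable_funM; first exact: measurable_dist_powR.
  by apply/measurable_EFinP/measurable_funTS; case: hdens.
- by apply: measurable_funeM; exact: measurable_root_density.
- move=> x Fx; rewrite -EFinM lee_fin -[h x in leLHS]root_densityK powRS// mulrCA [leRHS]mulrC.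
  apply: ler_wpM2l => //; rewrite -powRM//.
  by apply: ler_powRl; [exact: ltW|exact: mulr_ge0|exact: gG].
Qed.

End cell.

(** * Size of a cell against the integral of the root density *)

Section cell_vs_root_density.
Set Implicit Arguments.
Unset Strict Implicit.
Context {R : realType}.
Variables (r : R) (mu : probability (measurableTypeR R) R) (h : R -> R).
Hypotheses (r0 : 0 < r) (hdens : is_lebesgue_density mu h).
Local Notation leb := (@lebesgue_measure R).
Local Notation Q := (2 `^ (- r) * (1 + r)^-1).
Local Notation g := (fun x => h x `^ (1 / (1 + r))).
Implicit Types F B : set (measurableTypeR R).

Let g0 x : 0 <= g x. Proof. exact: powR_ge0. Qed.

(** On [B] the function [g] lies between [g x0 - eps] and [g x0 + eps]: the lower
value bounds the size [e] from below, the upper one the integral from above. *)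
Lemma integral_root_density_le F B (a e L eps : R) :
  measurable F -> measurable B -> B `<=` F -> leb B = L%:E ->
  0 <= e -> 0 <= eps -> (forall x y, B x -> B y -> `|g x - g y| <= eps) ->
  (\int[mu]_(x in F) (`|x - a| `^ r)%:E <= (Q * e `^ (1 + r))%:E)%E ->
  (\int[leb]_(x in B) (g x)%:E <= (e + 2 * eps * L)%:E)%E.
Proof.
move=> mF mB BF BL e0 eps0 osc le_e.
have L0 : 0 <= L by rewrite -lee_fin -BL.
have [B0|/set0P[x0 Bx0]] := eqVneq B set0.
  by rewrite B0 integral_set0 lee_fin addr_ge0// !mulr_ge0.
(* [g x0 - eps] may be negative, while the size bound needs a nonnegative one *)
pose u := Num.max (g x0 - eps) 0.
have u0 : 0 <= u by rewrite le_max lexx orbT.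
have uL : u * L <= e.
  apply: (cell_size_ge r0 hdens mF mB BF BL e0 u0 _ le_e) => x Bx.
  rewrite ge_max g0 andbT.
  by move: (osc _ _ Bx0 Bx); rewrite ler_norml => /andP[_]; lra.
apply: (@le_trans _ _ (\int[leb]_(x in B) (cst (g x0 + eps)%:E x))%E).
  apply: ge0_le_integral => //.
  - by move=> x _; rewrite lee_fin.
  - exact: (measurable_root_density r hdens).
  - move=> x Bx; rewrite lee_fin.
    by move: (osc _ _ Bx0 Bx); rewrite ler_norml => /andP[+ _]; lra.
rewrite (integral_cst_lebesgue _ mB BL) lee_fin.
have : g x0 - eps <= u by rewrite le_max lexx.
by move: uL; nra.
Qed.

Lemma measure_bounded_interval F (x0 A B : R) :
  is_interval (F : set R) -> F x0 -> F `<=` `[A, B] ->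
  exists s t, [/\ s <= t, F `<=` `[s, t] & leb F = (t - s)%:E].
Proof.
move=> /is_intervalP iF Fx0 FAB.
have lF : has_lbound (F : set R).
  by exists A => x /FAB/=; rewrite in_itv => /andP[].
have uF : has_ubound (F : set R).
  by exists B => x /FAB/=; rewrite in_itv => /andP[].
have st : inf (F : set R) <= sup (F : set R).
  by apply: (@le_trans _ _ x0); [apply: ge_inf|apply: ub_le_sup].
exists (inf (F : set R)), (sup (F : set R)); split => //.
  by move=> x Fx; rewrite /= in_itv/= ge_inf// ub_le_sup.
rewrite [in LHS]iF lebesgue_measure_itv /Rhull (asboolT lF) (asboolT uF)/= lte_fin.
case: ltP => [//|ts]; congr EFin; apply/esym/eqP; rewrite subr_eq0 eq_le.
by rewrite ts st.
Qed.

(** The optimal point of the cell is at least as good as the midpoint, about which the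
distortion is at most that of the constant density [(g x0 + eps)^(1+r)]. *)
Lemma le_integral_root_density F (A B e eps : R) :
  measurable F -> is_interval (F : set R) -> F `<=` `[A, B] ->
  0 <= e -> 0 <= eps -> (forall x y, F x -> F y -> `|g x - g y| <= eps) ->
  (forall b, ((Q * e `^ (1 + r))%:E <= \int[mu]_(x in F) (`|x - b| `^ r)%:E)%E) ->
  (e%:E <= \int[leb]_(x in F) (g x + 2 * eps)%:E)%E.
Proof.
move=> mF iF FAB e0 eps0 osc le_e.
have r1 : 0 < 1 + r by rewrite addr_gt0.
have Q0 : 0 < Q by rewrite mulr_gt0 ?invr_gt0// powR_gt0.
have [F0|/set0P[x0 Fx0]] := eqVneq F set0.
  move: (le_e 0); rewrite F0 !integral_set0 !lee_fin pmulr_rle0// => ee.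
  apply: (ler_powR_inv r1) => //; rewrite powR0 ?gt_eqF//.
have [s [t [st Fst Ft]]] := measure_bounded_interval iF Fx0 FAB.
have L0 : 0 <= t - s by rewrite subr_ge0.
pose v := g x0 + eps.
have v0 : 0 <= v by rewrite addr_ge0.
have := cell_size_le r0 hdens mF L0 _ v0 _ (le_e ((s + t) / 2)).
rewrite (_ : _ - _ = s); last by lra.
rewrite (_ : _ + (t - s) / 2 = t); last by lra.
move=> /(_ Fst) -/(_ _)/wrap[x Fx|].
  by move: (osc _ _ Fx0 Fx); rewrite /v ler_norml => /andP[+ _]; lra.
rewrite -lee_fin => /le_trans; apply.
rewrite -(integral_cst_lebesgue _ mF Ft).
apply: ge0_le_integral => //.
- apply/measurable_EFinP; apply: measurable_funD => //.
  by apply/measurable_EFinP; exact: (measurable_root_density r hdens).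
- move=> x Fx; rewrite lee_fin.
  by move: (osc _ _ Fx0 Fx); rewrite /v ler_norml => /andP[_]; lra.
Qed.

(** Each [x] of the cell is separated from [b] by a part [I] of the cell, of length
[|x - b|], on which [g] is at least [g x]; hence [|x - b| * g x] is at most the
integral of [g] over the cell. For monotone [g] the point [b] is the end of the
cell towards which [g] increases. *)
Lemma cell_size_le_integral_fill F (b e : R) :
  measurable F -> (\int[leb]_(x in F) (g x)%:E < +oo)%E -> 0 <= e ->
  (forall x, F x -> exists I : set (measurableTypeR R),
    [/\ measurable I, I `<=` F, leb I = `|x - b|%:E
      & forall y, I y -> g x <= g y]) ->
  ((Q * e `^ (1 + r))%:E <= \int[mu]_(x in F) (`|x - b| `^ r)%:E)%E ->
  ((Q `^ (1 / (1 + r)) * e)%:E <= \int[leb]_(x in F) (g x)%:E)%E.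
Proof.
move=> mF Gfin e0 fill le_e.
have Gnum : (\int[leb]_(x in F) (g x)%:E)%E \is a fin_num.
  by rewrite ge0_fin_numE// integral_ge0// => x _; rewrite lee_fin.
rewrite -(fineK Gnum) lee_fin.
apply: (cell_size_le_integral r0 hdens mF e0 _ _ le_e); first by rewrite fineK.
move=> x Fx; rewrite -lee_fin fineK//; have [I [mI IF Ixb gI]] := fill x Fx.
apply: (@le_trans _ _ (\int[leb]_(y in I) cst (g x)%:E y)%E).
  by rewrite (integral_cst_lebesgue _ mI Ixb) mulrC.
apply: (@le_trans _ _ (\int[leb]_(y in I) (g y)%:E)%E).
  apply: ge0_le_integral => //.
  - by move=> y _; rewrite lee_fin.
  - exact: (measurable_root_density r hdens).
apply: ge0_subset_integral => //.
  exact: (measurable_root_density r hdens).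
by move=> y _; rewrite lee_fin.
Qed.

Lemma cell_size_le_integral_nondecreasing F (e : R) :
  measurable F -> is_interval (F : set R) -> has_ubound (F : set R) ->
  (forall x y, F x -> F y -> x <= y -> g x <= g y) ->
  (\int[leb]_(x in F) (g x)%:E < +oo)%E -> 0 <= e ->
  (forall b, ((Q * e `^ (1 + r))%:E <= \int[mu]_(x in F) (`|x - b| `^ r)%:E)%E) ->
  ((Q `^ (1 / (1 + r)) * e)%:E <= \int[leb]_(x in F) (g x)%:E)%E.
Proof.
move=> mF iF uF ndg Gfin e0 le_e.
apply: (@cell_size_le_integral_fill F (sup (F : set R))) => // x Fx.
have xs : x <= sup (F : set R) by apply: ub_le_sup.
have IF : `[x, sup (F : set R)[ `<=` (F : set R).
  move=> y; rewrite /= in_itv/= => /andP[xy ys].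
  have [z Fz yz] := sup_gt (x := y) (S := F : set R) ltac:(by exists x) ys.
  by apply: (iF x z) => //; rewrite xy ltW.
exists [set` `[x, sup (F : set R)[]; split => //.
- rewrite lebesgue_measure_itv/= lte_fin distrC ger0_norm ?subr_ge0//.
  case: ltP => sx; first by rewrite -EFinB.
  by congr EFin; apply/esym/eqP; rewrite subr_eq0 eq_le xs sx.
- move=> y Iy; apply: ndg => //; first exact: IF.
  by move: Iy; rewrite /= in_itv/= => /andP[].
Qed.

Lemma cell_size_le_integral_nonincreasing F (e : R) :
  measurable F -> is_interval (F : set R) -> has_lbound (F : set R) ->
  (forall x y, F x -> F y -> x <= y -> g y <= g x) ->
  (\int[leb]_(x in F) (g x)%:E < +oo)%E -> 0 <= e ->
  (forall b, ((Q * e `^ (1 + r))%:E <= \int[mu]_(x in F) (`|x - b| `^ r)%:E)%E) ->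
  ((Q `^ (1 / (1 + r)) * e)%:E <= \int[leb]_(x in F) (g x)%:E)%E.
Proof.
move=> mF iF lF nig Gfin e0 le_e.
apply: (@cell_size_le_integral_fill F (inf (F : set R))) => // x Fx.
have sx : inf (F : set R) <= x by apply: ge_inf.
have IF : `]inf (F : set R), x] `<=` (F : set R).
  move=> y; rewrite /= in_itv/= => /andP[sy yx].
  have [z Fz zy] := inf_lt (x := y) (S := F : set R) ltac:(by exists x) sy.
  by apply: (iF z x) => //; rewrite yx andbT ltW.
exists [set` `]inf (F : set R), x]]; split => //.
- rewrite lebesgue_measure_itv/= lte_fin ger0_norm ?subr_ge0//.
  case: ltP => xs; first by rewrite -EFinB.
  by congr EFin; apply/esym/eqP; rewrite subr_eq0 eq_le xs sx.
- move=> y Iy; apply: nig => //; first exact: IF.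
  by move: Iy; rewrite /= in_itv/= => /andP[].
Qed.

End cell_vs_root_density.

(** * The cells of a Gersho quantizer *)

Section gersho_cells.
Set Implicit Arguments.
Unset Strict Implicit.
Context {R : realType}.
Local Open Scope ereal_scope.
Implicit Types (mu : probability (measurableTypeR R) R) (r : R) (q : R -> R).

(** On the subsets of [A] the conditional probability is the multiple [1 / mu A] of
[mu], and the complement of [A] is a null set. *)
Lemma integral_cond_prob mu (A : set (measurableTypeR R)) (mA : measurable A)
    (f : measurableTypeR R -> \bar R) :
  mu A != 0 -> measurable_fun setT f -> (forall x, 0 <= f x) ->
  \int[cond_prob mu mA]_x f x = (fine (mu A))^-1%:E * \int[mu]_(x in A) f x.
Proof.
move=> A0 mf f0.
have Afin : mu A \is a fin_num by exact: fin_num_measure.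
have condE : cond_prob mu mA = (fun U => mu (U `&` A) * (fine (mu A))^-1%:E) :> (set _ -> \bar R).
  rewrite /cond_prob/= /mnormalize/= /mrestr setTI ifF//.
  by rewrite (negbTE A0)/=; apply/negbTE; rewrite lt_eqF// ltey_eq Afin.
have condC : cond_prob mu mA (~` A) = 0.
  by rewrite condE setICl measure0 mul0e.
rewrite (@ge0_negligible_integral _ _ _ _ setT (~` A) _ (measurableC mA) _ mf)//.
rewrite setTD setCK.
have k0 : (0 <= (fine (mu A))^-1)%R by rewrite invr_ge0 fine_ge0.
rewrite (eq_measure_integral (mscale (NngNum k0) mu)).
  rewrite ge0_integral_mscale//; exact: measurable_funTS.
move=> B mB BA; transitivity (cond_prob mu mA B) => //.
by rewrite condE/= /mscale/= setIidl// muleC.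
Qed.

(** Optimality for the conditional probability transfers to [mu] restricted to the
cell. For a null cell the default measure of the conditional probability says
nothing, but then the left-hand side vanishes. *)
Lemma gersho_cell_optimal mu r n q (a b : R) :
  gersho mu r n q -> range q a ->
  \int[mu]_(x in codecell q a) (`|x - a| `^ r)%:E <=
  \int[mu]_(x in codecell q a) (`|x - b| `^ r)%:E.
Proof.
move=> [[mq _] [_ _ opt _]] qa.
have mA : measurable (codecell q a).
  by rewrite /codecell -[_ @^-1` _]setTI; apply: mq => //; exact: measurable_set1.
have f0 c (x : R) : 0 <= (`|x - c| `^ r)%:E by rewrite lee_fin powR_ge0.
have [A0|A0] := eqVneq (mu (codecell q a)) 0.
  rewrite (_ : \int[mu]_(x in _) (`|x - a| `^ r)%:E = 0); last first.
    rewrite (@ge0_negligible_integral _ _ _ _ _ (codecell q a))//.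
      by rewrite setDv integral_set0.
    exact: measurable_dist_powR.
  by apply: integral_ge0.
have Afin : mu (codecell q a) \is a fin_num by exact: fin_num_measure.
have := opt _ mA qa; rewrite /optimal_point => oa.
have : \int[cond_prob mu mA]_x (`|x - a| `^ r)%:E <=
       \int[cond_prob mu mA]_x (`|x - b| `^ r)%:E.
  by rewrite oa; apply: ereal_inf_lbound; exists b.
have condE c := integral_cond_prob mA A0 (@measurable_dist_powR R setT c r) (f0 c).
rewrite !condE.
rewrite lee_pmul2l// lte_fin invr_gt0 fine_gt0//.
by rewrite lt0e A0 measure_ge0/= ltey_eq Afin.
Qed.

Lemma ge0_integral_partition (nu : {measure set (measurableTypeR R) -> \bar R})
    n (F : nat -> set (measurableTypeR R)) (D : set (measurableTypeR R))
    (f : measurableTypeR R -> \bar R) :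
  (forall i, measurable (F i)) -> trivIset `I_n F -> \bigcup_(i in `I_n) F i = setT ->
  measurable D -> measurable_fun D f -> (forall x, 0 <= f x) ->
  \int[nu]_(x in D) f x = \sum_(0 <= i < n) \int[nu]_(x in F i `&` D) f x.
Proof.
move=> mF tF FT mD mf f0.
have In : `I_n = [set` index_iota 0 n].
  by apply/seteqP; split => i /=; rewrite mem_index_iota.
have DE : D = \big[setU/set0]_(i <- index_iota 0 n) (F i `&` D).
  by rewrite -big_distrl/= -bigcup_seq -In FT setTI.
rewrite [in LHS]DE ge0_integral_bigsetU//.
- by move=> i; exact: measurableI.
- exact: iota_uniq.
- by rewrite -In; apply: trivIset_setIr.
- by rewrite -DE.
Qed.

(** What the asymptotic analysis retains of a Gersho quantizer. The two bounds around
[e] say that the infimum of the distortion of each cell over all code points is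
attained and equals [e]. *)
Definition equal_distortion_cells mu r n (e : R)
    (F : nat -> set (measurableTypeR R)) : Prop :=
  [/\ forall i, measurable (F i), trivIset `I_n F, \bigcup_(i in `I_n) F i = setT
    & forall i, (i < n)%N -> [/\ is_interval (F i : set R),
       exists a, \int[mu]_(x in F i) (`|x - a| `^ r)%:E <= e%:E
     & forall b, e%:E <= \int[mu]_(x in F i) (`|x - b| `^ r)%:E]].

(** The bound by the moment of [mu] comes from comparing every code point with 0; it shows
in particular that the distortion is finite. *)
Lemma gersho_equal_distortion_cells mu r n q : (0 < n)%N ->
  gersho mu r n q -> \int[mu]_x (`|x| `^ r)%:E < +oo ->
  exists e F, [/\ (0 <= e)%R, distortion mu q r = (n%:R * e)%:E,
    (n%:R * e)%:E <= \int[mu]_x (`|x| `^ r)%:E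
    & equal_distortion_cells mu r n e F].
Proof.
move=> n0 G mom; have [[mq _] [cardq iq _ eqd]] := G.
have mcell a : measurable (codecell q a).
  by rewrite /codecell -[_ @^-1` _]setTI; apply: mq => //; exact: measurable_set1.
have /card_set_bijP[f [fI finj fsurj]] : (`I_n #= range q)%card by rewrite card_eq_sym.
pose F i := codecell q (f i).
have mF i : measurable (F i) by exact: mcell.
have f0 c (x : R) : 0 <= (`|x - c| `^ r)%:E by rewrite lee_fin powR_ge0.
have tF : trivIset `I_n F.
  apply/trivIsetP => i j iI jI ij; apply/seteqP; split => // x [/= qi qj].
  by move/eqP: ij; apply; apply: finj; rewrite ?inE// -qi -qj.
have FT : \bigcup_(i in `I_n) F i = setT.
  apply/seteqP; split => // x _.
  have [|i iI fi] := fsurj (q x); first by exists x.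
  by exists i.
have fq i : (i < n)%N -> range q (f i) by exact: fI.
have mD : measurable_fun [set: measurableTypeR R]
    (fun x : measurableTypeR R => (`|x - q x| `^ r)%:E).
  apply/measurable_EFinP.
  have m1 : measurable_fun [set: measurableTypeR R] (fun x : measurableTypeR R => x - q x : R)%R.
    exact: measurable_funB.
  have m2 : measurable_fun [set: measurableTypeR R] (fun x : measurableTypeR R => `|x - q x| : R)%R.
    exact: measurableT_comp.
  exact: (measurableT_comp (measurable_powR _) m2).
have le_mom : distortion mu q r <= \int[mu]_x (`|x| `^ r)%:E.
  rewrite /distortion (ge0_integral_partition mu (n := n) (F := F))//.
  rewrite [leRHS](ge0_integral_partition mu (n := n) (F := F))//; last first.
    by apply/measurable_EFinP; apply: (measurableT_comp (measurable_powR _)).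
  rewrite big_seq [leRHS]big_seq; apply: lee_sum => i.
  rewrite mem_index_iota/= => iI; rewrite setIT.
  have -> : \int[mu]_(x in F i) (`|x - q x| `^ r)%:E =
      \int[mu]_(x in F i) (`|x - f i| `^ r)%:E.
    by apply: eq_integral => x /set_mem ->.
  have -> : \int[mu]_(x in F i) (`|x| `^ r)%:E =
      \int[mu]_(x in F i) (`|x - 0| `^ r)%:E.
    by apply: eq_integral => x _; rewrite subr0.
  exact: gersho_cell_optimal G (fq i iI).
have Dfin : distortion mu q r \is a fin_num.
  rewrite ge0_fin_numE; first exact: le_lt_trans mom.
  by apply: integral_ge0 => x _; rewrite lee_fin powR_ge0.
have nn0 : (n%:R : R) != 0%R by rewrite pnatr_eq0 -lt0n.
pose e := (n%:R^-1 * fine (distortion mu q r))%R.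
have De : distortion mu q r = (n%:R * e)%:E by rewrite /e mulVKf// fineK.
exists e, F; split => //.
- rewrite mulr_ge0// fine_ge0//.
  by apply: integral_ge0 => x _; rewrite lee_fin powR_ge0.
- by rewrite -De.
have eE : e%:E = n%:R^-1%:E * distortion mu q r by rewrite /e EFinM fineK.
split => // i iI; split; first exact: (iq _ (fq i iI)).
- by exists (f i); rewrite eqd ?eE//; exact: fq.
- move=> b; rewrite eE -(eqd _ (fq i iI)).
  exact: gersho_cell_optimal G (fq i iI).
Qed.

End gersho_cells.

(** * Uniform continuity on a segment, and monotone tails *)

Section uniform_continuity.
Set Implicit Arguments.
Unset Strict Implicit.
Context {R : realType}.

(** Heine-Cantor, from the near-covering form of compactness: the radius that
continuity provides at [x] works, after halving, in a neighbourhood of [x]. *)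
Lemma segment_uniform_continuity (f : R -> R) (A B eps : R) :
  {within `[A, B], continuous f} -> 0 < eps ->
  exists2 d : R, 0 < d & forall x y, x \in `[A, B] -> y \in `[A, B] ->
    `|x - y| <= d -> `|f x - f y| <= eps.
Proof.
move=> /subspace_continuousP cf eps0.
pose K : set R := [set` `[A, B]].
pose P (d x : R) := forall y, K y -> `|x - y| <= d -> `|f x - f y| <= eps.
have /compact_near_coveringP/near_covering_withinP cov := @segment_compact R A B.
case: (cov R (0^'+) P _).
- move=> x Kx.
  have e2 : 0 < eps / 2 by rewrite divr_gt0.
  have /cvgrPdist_lt/(_ _ e2) := cf x Kx.
  rewrite near_withinE => /nbhs_ballP[d/= d0 hd].
  have d2 : 0 < d / 2 by rewrite divr_gt0.
  have fK y : K y -> `|x - y| < d -> `|f x - f y| < eps / 2.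
    by move=> Ky xy; apply: hd.
  near=> x' e => Kx' y Ky x'y.
  have xx' : `|x - x'| < d / 2.
    by near: x'; apply: (@cvgr_dist_lt _ _ _ (nbhs x) _ id).
  have ed : e < d / 2 by near: e; exact: nbhs_right_lt.
  have -> : f x' - f y = (f x - f y) - (f x - f x') by lra.
  apply: (le_trans (ler_normB _ _)); apply: ltW.
  have xx'd : `|x - x'| < d by lra.
  have xyd : `|x - y| < d.
    have -> : x - y = (x - x') + (x' - y) by lra.
    apply: (le_lt_trans (ler_normD _ _)); rewrite [d]splitr.
    by apply: ltrD => //; apply: le_lt_trans ed.
  by rewrite [eps]splitr ltrD// fK.
- move=> d /= d0 hd; exists (d / 2); first by rewrite divr_gt0.
  move=> x y Kx Ky; apply: hd => //=; last by rewrite divr_gt0.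
  by rewrite sub0r normrN ger0_norm ?divr_ge0 ?ltW// gtr_pMr// invf_lt1// ltr1n.
Unshelve. all: by end_near. Qed.
End uniform_continuity.

Section level_sets.
Set Implicit Arguments.
Unset Strict Implicit.
Context {R : realType}.
Variables (h : R -> R).
Hypothesis (h0 : forall x, 0 <= h x).

Lemma level_set_within (l0 l A B p : R) :
  0 < p -> 0 < l < l0 ->
  {within density_support h, continuous h} ->
  [set x | l <= h x] = [set` `[A, B]] ->
  {within `[A, B], continuous (fun x => h x `^ p)}.
Proof.
move=> p0 /andP[l0' _] ch lAB.
have sub : [set` `[A, B]] `<=` density_support h.
  rewrite -lAB => x /= lx; apply: subset_closure => /=.
  by rewrite gt_eqF// (lt_le_trans l0').
have /subspace_continuousP cK := continuous_subspaceW sub ch.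
apply/subspace_continuousP => x Kx.
have C := continuous_cvg _ (@continuous_norm_powR R p p0 (h x)) (cK x Kx).
have hp : (fun y => h y `^ p) = (fun y => `|h y| `^ p).
  by apply/funext => y; rewrite ger0_norm.
by rewrite hp; exact: C.
Qed.

Lemma level_set_mem (l A B z : R) :
  [set x | l <= h x] = [set` `[A, B]] -> (l <= h z) = (A <= z <= B).
Proof.
move=> /seteqP[sub1 sub2]; apply/idP/idP => [/sub1|zAB]; first by rewrite /= in_itv.
by apply: sub2; rewrite /= in_itv.
Qed.

(** For [h x > 0] the level set of height [h x] is an interval that contains [x] and
[A], hence also [y]. *)
Lemma unimodal_left (l0 A B l x y : R) :
  (forall l, 0 < l < l0 -> exists a b : R, a <= b /\ [set x | l <= h x] = [set` `[a, b]]) ->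
  0 < l < l0 -> [set x | l <= h x] = [set` `[A, B]] -> A <= B ->
  x <= y -> y < A -> h x <= h y.
Proof.
move=> uni /andP[l1 l2] lAB AB xy yA.
have [->//|hx0] := eqVneq (h x) 0.
have inK z := level_set_mem z lAB.
have hxl : h x < l.
  by rewrite ltNge inK; apply/negP => /andP[]; lra.
have hxpos : 0 < h x by rewrite lt0r hx0 h0.
have [a [b [_ E]]] := uni (h x) ltac:(by rewrite hxpos (lt_trans hxl)).
have : [set` `[a, b]] x by rewrite -E /=.
have : [set` `[a, b]] A.
  by rewrite -E /= (le_trans (ltW hxl))// inK lexx AB.
rewrite /= !in_itv/= => /andP[_ Ab] /andP[ax _].
have : [set` `[a, b]] y by rewrite /= in_itv/=; apply/andP; split; lra.
by rewrite -E.
Qed.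

Lemma unimodal_right (l0 A B l x y : R) :
  (forall l, 0 < l < l0 -> exists a b : R, a <= b /\ [set x | l <= h x] = [set` `[a, b]]) ->
  0 < l < l0 -> [set x | l <= h x] = [set` `[A, B]] -> A <= B ->
  x <= y -> B < x -> h y <= h x.
Proof.
move=> uni /andP[l1 l2] lAB AB xy xB.
have [->//|hy0] := eqVneq (h y) 0.
have inK z := level_set_mem z lAB.
have hyl : h y < l.
  by rewrite ltNge inK; apply/negP => /andP[]; lra.
have hypos : 0 < h y by rewrite lt0r hy0 h0.
have [a [b [_ E]]] := uni (h y) ltac:(by rewrite hypos (lt_trans hyl)).
have : [set` `[a, b]] y by rewrite -E /=.
have : [set` `[a, b]] B.
  by rewrite -E /= (le_trans (ltW hyl))// inK lexx AB.
rewrite /= !in_itv/= => /andP[aB _] /andP[_ yb].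
have : [set` `[a, b]] x by rewrite /= in_itv/=; apply/andP; split; lra.
by rewrite -E.
Qed.
End level_sets.

(** * The sum of the cell sizes at a fixed level *)

Section level_estimate.
Set Implicit Arguments.
Unset Strict Implicit.
Context {R : realType}.
Variables (r : R) (mu : probability (measurableTypeR R) R) (h : R -> R).
Hypotheses (r0 : 0 < r) (hdens : is_lebesgue_density mu h).
Local Notation leb := (@lebesgue_measure R).
Local Notation Q := (2 `^ (- r) * (1 + r)^-1).
Local Notation g := (fun x => h x `^ (1 / (1 + r))).
Variables (l0 l A B eps d e : R) (n : nat) (F : nat -> set (measurableTypeR R)).
Hypothesis uni : forall l, 0 < l < l0 ->
  exists a b : R, a <= b /\ [set x | l <= h x] = [set` `[a, b]].
Hypotheses (hl : 0 < l < l0) (AB : A <= B)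
  (lAB : [set x | l <= h x] = [set` `[A, B]]).
Hypotheses (eps0 : 0 <= eps)
  (osc : forall x y, x \in `[A, B] -> y \in `[A, B] -> `|x - y| <= d ->
         `|g x - g y| <= eps).
Hypotheses (e0 : 0 <= e) (cells : equal_distortion_cells mu r n (Q * e `^ (1 + r)) F).
Hypothesis mesh : e <= l `^ (1 / (1 + r)) * d.

Let K : set (measurableTypeR R) := [set` `[A, B]].
Let mK : measurable K. Proof. exact: measurable_itv. Qed.
Let g0 x : 0 <= g x. Proof. exact: powR_ge0. Qed.
Let h0 x : 0 <= h x. Proof. by case: hdens. Qed.
Let mF i : measurable (F i). Proof. by case: cells. Qed.
Let l_gt0 : 0 < l. Proof. by case/andP: hl. Qed.
Let p_gt0 : 0 < 1 / (1 + r). Proof. by rewrite divr_gt0// addr_gt0. Qed.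
Let mg D := @measurable_root_density R r mu h hdens D.
Let lebK : leb K = (B - A)%:E.
Proof.
rewrite /K lebesgue_measure_itv/= lte_fin.
case: ltP => [//|BA]; congr EFin; apply/esym/eqP; rewrite subr_eq0 eq_le.
by rewrite AB BA.
Qed.

(** For [x < y] in the trace of a cell on [K], the segment from [x] to [y] lies in the
cell and [h >= l] there, so the size [e] of the cell is at least
[l^(1/(1+r)) * (y - x)]. This bounds [y - x] by [d]. *)
Let oscF i : (i < n)%N ->
  forall x y, (F i `&` K) x -> (F i `&` K) y -> `|g x - g y| <= eps.
Proof.
move=> iI.
suff le_osc x y : x <= y -> (F i `&` K) x -> (F i `&` K) y -> `|g x - g y| <= eps.
  move=> x y Kx Ky; case: (leP x y) => [xy|/ltW yx]; first exact: le_osc.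
  by rewrite distrC; exact: le_osc.
move=> xy [Fx Kx] [Fy Ky].
apply: osc => //; have [_ _ _ /(_ i iI)[iF [a le_e] _]] := cells.
rewrite distrC ger0_norm ?subr_ge0// -(@ler_pM2l _ (l `^ (1 / (1 + r)))) ?powR_gt0//.
apply: le_trans mesh.
have xyI : `[x, y] `<=` F i.
  by move=> z; rewrite /= in_itv/= => xzy; apply: (iF x y).
apply: (cell_size_ge r0 hdens (mF i) _ xyI _ e0 _ _ le_e) => //.
- rewrite lebesgue_measure_itv/= lte_fin.
  case: ltP => [//|yx]; congr EFin; apply/esym/eqP; rewrite subr_eq0 eq_le.
  by rewrite xy yx.
- exact: powR_ge0.
- move=> z; rewrite /= in_itv/= => /andP[xz zy].
  apply: ler_powRl; [exact: ltW|exact: ltW|].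
  have : [set` `[A, B]] z.
    move: Kx Ky; rewrite /K/= !in_itv/= => /andP[? ?] /andP[? ?].
    by apply/andP; split; lra.
  by rewrite -lAB.
Qed.

Let sum_e : (\sum_(0 <= i < n) e%:E = (n%:R * e)%:E)%E.
Proof. by rewrite sumEFin big_const_nat subn0 iter_addr_0 mulr_natl. Qed.

Let integral_K : (\int[leb]_(x in K) (g x + 2 * eps)%:E =
  \int[leb]_(x in K) (g x)%:E + (2 * eps * (B - A))%:E)%E.
Proof.
rewrite -(integral_cst_lebesgue _ mK lebK) -ge0_integralD//.
- by move=> x _; rewrite lee_fin.
- by move=> x _; rewrite lee_fin mulr_ge0.
Qed.

(** Only the traces of the cells on [K] are used, so cells that stick out of
[K] need no separate treatment. *)
Lemma integral_level_le :
  (\int[leb]_(x in K) (g x)%:E <= (n%:R * e + 2 * eps * (B - A))%:E)%E.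
Proof.
have [_ tF FT cF] := cells.
have le0 (x : measurableTypeR R) : (0 <= cst (2 * eps)%:E x)%E.
  by rewrite lee_fin mulr_ge0.
rewrite EFinD -sum_e -(integral_cst_lebesgue _ mK lebK).
rewrite (ge0_integral_partition leb mF tF FT mK)//.
rewrite [X in (_ <= _ + X)%E](ge0_integral_partition leb mF tF FT mK)//.
rewrite -big_split/= big_seq [leRHS]big_seq; apply: lee_sum => i.
rewrite mem_index_iota/= => iI; have [iF [a le_e] _] := cF i iI.
have mFK : measurable (F i `&` K) by exact: measurableI.
have LE : leb (F i `&` K) = (fine (leb (F i `&` K)))%:E.
  rewrite fineK// ge0_fin_numE//.
  apply: (@le_lt_trans _ _ (leb K)); last by rewrite lebK ltry.
  by apply: le_measure; rewrite ?inE//; exact: subIsetr.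
rewrite (integral_cst_lebesgue _ mFK LE) -EFinD.
exact: (integral_root_density_le r0 hdens (mF i) mFK _ LE e0 eps0 (oscF iI) le_e).
Qed.

(** Every cell falls under one of four cases: it contains [A] or [B], lies to the left
of [K], to the right of [K], or inside [K]. *)
Lemma le_integral_level : (\int[leb]_x (g x)%:E < +oo)%E ->
  ((n%:R * e)%:E <= \int[leb]_(x in K) (g x)%:E + (2 * eps * (B - A))%:E +
    ((Q `^ (1 / (1 + r)))^-1)%:E * \int[leb]_(x in ~` K) (g x)%:E + (2 * e)%:E)%E.
Proof.
move=> gfin; have [_ tF FT cF] := cells.
set k := (Q `^ (1 / (1 + r)))^-1.
have k0 : 0 <= k by rewrite invr_ge0 powR_ge0.
have mKC : measurable (~` K) by exact: measurableC.
(* The cells containing [A] or [B] are counted by integrating the constant [e] against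
   Dirac measures, so that each cell is bounded by a sum of four
   integrals, all summed over the partition by the same lemma. *)
have dirac_e (x : measurableTypeR R) :
    (e%:E = \sum_(0 <= i < n) \int[\d_x]_(y in F i `&` setT) (cst e%:E y))%E.
  rewrite -(ge0_integral_partition (\d_x) mF tF FT)//.
  by rewrite integral_cst//= diracT mule1.
rewrite -integral_K -ge0_integralZl_EFin//; last first.
  by move=> x _; rewrite lee_fin.
have -> : ((2 * e)%:E = e%:E + e%:E)%E by rewrite -EFinD mulr2n mulrDl mul1r.
rewrite [X in (_ <= _ + (X + _))%E](dirac_e A) [X in (_ <= _ + (_ + X))%E](dirac_e B).
rewrite -sum_e.
have mg2 D : measurable_fun D (fun x : measurableTypeR R => (g x + 2 * eps)%:E).
  apply/measurable_EFinP; apply: measurable_funD => //.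
  by apply/measurable_EFinP; exact: mg.
have mkg D : measurable_fun D (fun x : measurableTypeR R => k%:E * (g x)%:E)%E.
  by apply: measurable_funeM; exact: mg.
have g20 x : (0 <= (g x + 2 * eps)%:E)%E by rewrite lee_fin addr_ge0// mulr_ge0.
have kg0 x : (0 <= k%:E * (g x)%:E)%E by rewrite mule_ge0// lee_fin.
rewrite (ge0_integral_partition leb mF tF FT mK)//.
rewrite (ge0_integral_partition leb mF tF FT mKC)//.
rewrite -!big_split/= big_seq [leRHS]big_seq; apply: lee_sum => i.
rewrite mem_index_iota/= => iI; have [iF [a le_e] ge_e] := cF i iI.
set I1 := (\int[leb]_(x in F i `&` K) _)%E.
set I2 := (\int[leb]_(x in F i `&` ~` K) _)%E.
set IA := (\int[_]_(x in _) _)%E.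
set IB := (\int[_]_(x in _) _)%E.
have I10 : (0 <= I1)%E by exact: integral_ge0.
have I20 : (0 <= I2)%E by exact: integral_ge0.
have e0' : (0 <= e%:E)%E by rewrite lee_fin.
have IA0 : (0 <= IA)%E by exact: integral_ge0.
have IB0 : (0 <= IB)%E by exact: integral_ge0.
have I120 : (0 <= I1 + I2)%E by exact: adde_ge0.
have IAB0 : (0 <= IA + IB)%E by exact: adde_ge0.
have subg D : measurable D -> (\int[leb]_(x in D) (g x)%:E < +oo)%E.
  move=> mD; apply: le_lt_trans gfin; apply: ge0_subset_integral => //.
  by move=> x _; rewrite lee_fin.
have outer : ((Q `^ (1 / (1 + r)) * e)%:E <= \int[leb]_(x in F i) (g x)%:E)%E ->
    F i `<=` ~` K -> (e%:E <= I2)%E.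
  move=> eg FK; rewrite /I2 setIidl// ge0_integralZl_EFin//; last first.
    by move=> x _; rewrite lee_fin.
  have Qp0 : 0 < Q `^ (1 / (1 + r)).
    by rewrite powR_gt0// mulr_gt0 ?powR_gt0// invr_gt0 addr_gt0.
  apply: le_trans (lee_wpmul2l _ eg); last by rewrite lee_fin.
  by rewrite -EFinM /k mulKf// gt_eqF.
have [FA|nFA] := pselect (F i A).
  rewrite (_ : e%:E = IA); last first.
    by rewrite /IA integral_cst//= ?diracE ?mem_set ?mule1//; exact: measurableI.
  by rewrite -[leLHS]add0e leeD// leeDl.
have [FB|nFB] := pselect (F i B).
  rewrite (_ : e%:E = IB); last first.
    by rewrite /IB integral_cst//= ?diracE ?mem_set ?mule1//; exact: measurableI.
  by rewrite -[leLHS]add0e leeD// leeDr.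
have [[x Fx xA]|noL] := pselect (exists2 x, F i x & x < A).
  have FltA y : F i y -> y < A.
    by move=> Fy; rewrite ltNge; apply/negP => Ay; apply: nFA; apply: (iF x y) => //; rewrite (ltW xA).
  have : (e%:E <= I2)%E.
    apply: outer; last by move=> y /FltA yA; rewrite /K/= in_itv/= => /andP[]; lra.
    apply: (cell_size_le_integral_nondecreasing r0 hdens) => //.
    + by exists A => y /FltA/ltW.
    + move=> y z Fy Fz yz; apply: ler_powRl => //; first exact: ltW.
      exact: (unimodal_left h0 uni hl lAB AB yz (FltA _ Fz)).
    + exact: subg.
  by move=> eI2; rewrite -[leLHS]adde0 leeD// (le_trans eI2)// leeDr.
have [[x Fx xB]|noR] := pselect (exists2 x, F i x & B < x).
  have FgtB y : F i y -> B < y.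
    by move=> Fy; rewrite ltNge; apply/negP => yB; apply: nFB; apply: (iF y x) => //; rewrite (ltW xB) yB.
  have : (e%:E <= I2)%E.
    apply: outer; last by move=> y /FgtB yB; rewrite /K/= in_itv/= => /andP[_]; lra.
    apply: (cell_size_le_integral_nonincreasing r0 hdens) => //.
    + by exists B => y /FgtB/ltW.
    + move=> y z Fy Fz yz; apply: ler_powRl => //; first exact: ltW.
      exact: (unimodal_right h0 uni hl lAB AB yz (FgtB _ Fy)).
    + exact: subg.
  by move=> eI2; rewrite -[leLHS]adde0 leeD// (le_trans eI2)// leeDr.
have FK : F i `<=` K.
  move=> x Fx; rewrite /K/= in_itv/=; apply/andP; split; rewrite leNgt; apply/negP => xx.
    by apply: noL; exists x.
  by apply: noR; exists x.
have : (e%:E <= I1)%E.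
  rewrite /I1 setIidl//.
  apply: (le_integral_root_density r0 hdens (mF i) iF FK e0 eps0) => // x y Fx Fy.
  by apply: (oscF iI); split => //; exact: FK.
by move=> eI1; rewrite -[leLHS]adde0 leeD// (le_trans eI1)// leeDl.
Qed.

End level_estimate.

(** * Letting the level decrease to zero *)

Section limit.
Set Implicit Arguments.
Unset Strict Implicit.
Context {R : realType}.
Variables (r : R) (mu : probability (measurableTypeR R) R) (h : R -> R).
Hypotheses (r0 : 0 < r) (hdens : is_lebesgue_density mu h) (hunim : weakly_unimodal h).
Local Notation leb := (@lebesgue_measure R).
Local Notation Q := (2 `^ (- r) * (1 + r)^-1).
Local Notation g := (fun x => h x `^ (1 / (1 + r))).

Let g0 x : 0 <= g x. Proof. exact: powR_ge0. Qed.
Let h0 x : 0 <= h x. Proof. by case: hdens. Qed.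
Let p_gt0 : 0 < 1 / (1 + r). Proof. by rewrite divr_gt0// addr_gt0. Qed.
Let mg D := @measurable_root_density R r mu h hdens D.

(** The level sets increase to [{h > 0}], and [g] vanishes elsewhere. *)
Lemma integral_level_sets_cvg (l : nat -> R) :
  (forall i, 0 < l i) -> {homo l : i j / (i <= j)%N >-> j <= i} -> l i @[i --> \oo] --> 0 ->
  (\int[leb]_(x in [set x | (l i <= h x)%R]) (g x)%:E @[i --> \oo] -->
   \int[leb]_x (g x)%:E)%E.
Proof.
move=> l_gt0 l_dec l_cvg; have [mh _ _] := hdens.
pose K i : set (measurableTypeR R) := [set x | l i <= h x].
have mK i : measurable (K i).
  rewrite (_ : K i = [set: measurableTypeR R] `&` h @^-1` `[l i, +oo[).
    by apply: mh => //; exact: measurable_itv.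
  by rewrite setTI; apply/seteqP; split => x; rewrite /K/= in_itv/= andbT.
have -> : (\int[leb]_x (g x)%:E = \int[leb]_(x in \bigcup_i K i) (g x)%:E)%E.
  rewrite [RHS]integral_mkcond; apply: eq_integral => x _; rewrite patchE.
  case: ifPn => // /negP xK; congr EFin.
  have [->|hx0] := eqVneq (h x) 0; first by rewrite powR0// gt_eqF.
  exfalso; apply: xK; apply/mem_set.
  have hx : 0 < h x by rewrite lt0r hx0 h0.
  have /cvgr0_norm_lt/(_ _ hx)[i _ /(_ i (leqnn i))] := l_cvg.
  by rewrite /= ger0_norm ?(ltW (l_gt0 i))// => /ltW lx; exists i.
apply: (@ge0_nondecreasing_set_cvg_integral _ _ _ K) => //.
- by move=> i j ij; rewrite subsetEset => x; apply: le_trans; exact: l_dec.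
- by move=> i x _; rewrite lee_fin.
Qed.

(** The rank [N] depends only on the moment bound [M] and on [eta], and [n * e]
is controlled for all families of equal-distortion cells at once. *)
Lemma normalized_cell_size_cvg (M J eta : R) :
  (\int[leb]_x (g x)%:E = J%:E)%E -> 0 < eta -> 0 <= M ->
  exists N : nat, forall n e F, (N <= n)%N -> 0 <= e ->
    n%:R * (Q * e `^ (1 + r)) <= M ->
    equal_distortion_cells mu r n (Q * e `^ (1 + r)) F ->
    `|J - n%:R * e| <= eta.
Proof.
move=> gJ eta0 M0; have [ch [l0 [l0_gt0 uni]]] := hunim.
have r1 : 0 < 1 + r by rewrite addr_gt0.
have Q0 : 0 < Q by rewrite mulr_gt0 ?invr_gt0// powR_gt0.
pose k := (Q `^ (1 / (1 + r)))^-1.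
have k0 : 0 < k by rewrite invr_gt0 powR_gt0.
(* The error is split into quarters of [eta]: one for the mass [delta] outside [K] and its
   multiple [k * delta], one for the oscillation of [g] on [K], one for the two cells at the
   ends of [K]. *)
pose delta := eta / (4 * (1 + k)).
have delta0 : 0 < delta by rewrite divr_gt0// mulr_gt0// addr_gt0.
have deltaE : delta * (1 + k) = eta / 4.
  by rewrite /delta; field; rewrite gt_eqF// addr_gt0.
have [l [hl Jl]] : exists l, 0 < l < l0 /\
    ((J - delta)%:E < \int[leb]_(x in [set x | (l <= h x)%R]) (g x)%:E)%E.
  pose l i : R := l0 / 2 * harmonic i.
  have l_gt0 i : 0 < l i by rewrite !mulr_gt0// invr_gt0.
  have l_dec : {homo l : i j / (i <= j)%N >-> j <= i}.
    move=> i j ij; rewrite /l ler_pM2l ?divr_gt0// lef_pV2 ?posrE//.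
    by rewrite ler_nat ltnS.
  have l_cvg : l i @[i --> \oo] --> 0.
    rewrite -(mulr0 (l0 / 2)); apply: cvgM; first exact: cvg_cst.
    exact: cvg_harmonic.
  have := integral_level_sets_cvg l_gt0 l_dec l_cvg; rewrite gJ.
  move=> /fine_cvgP[Cfin C].
  have Jlt : J - delta < J by lra.
  near \oo => i; exists (l i); split.
    rewrite l_gt0/=.
    have : l i <= l0 / 2 by rewrite /l ger_pMr ?divr_gt0// invf_le1// ler1n.
    by move=> /le_lt_trans; apply; lra.
  rewrite -[ltRHS]fineK ?lte_fin; last by near: i.
  by near: i; exact: (cvgr_gt _ C).
have [A [B [AB lAB]]] := uni _ hl.
pose K : set (measurableTypeR R) := [set` `[A, B]].
have mK : measurable K by exact: measurable_itv.
rewrite lAB -/K in Jl.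
have cK := level_set_within h0 p_gt0 hl ch lAB.
have BA0 : 0 < B - A + 1 by lra.
pose eps := eta / (8 * (B - A + 1)).
have eps0 : 0 < eps by rewrite divr_gt0// mulr_gt0.
have epsE : 2 * eps * (B - A) <= eta / 4.
  have -> : eta / 4 = 2 * eps * (B - A + 1) by rewrite /eps; field; rewrite gt_eqF.
  by rewrite ler_wpM2l ?lerDl// mulr_ge0// ltW.
have [d d0 osc] := segment_uniform_continuity cK eps0.
have /andP[l_gt0 _] := hl.
pose tau := Num.min (l `^ (1 / (1 + r)) * d) (eta / 8).
have tau0 : 0 < tau by rewrite lt_min mulr_gt0 ?powR_gt0//= divr_gt0.
have split_int : (J%:E = \int[leb]_(x in K) (g x)%:E + \int[leb]_(x in ~` K) (g x)%:E)%E.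
  rewrite -gJ -(setUv K) ge0_integral_setU//.
  - exact: measurableC.
  - by move=> x _; rewrite lee_fin.
  - by apply/disj_set2P; rewrite setICr.
have gfin : (\int[leb]_x (g x)%:E < +oo)%E by rewrite gJ ltry.
have iK0 : (0 <= \int[leb]_(x in K) (g x)%:E)%E.
  by apply: integral_ge0 => x _; rewrite lee_fin.
have iKC0 : (0 <= \int[leb]_(x in ~` K) (g x)%:E)%E.
  by apply: integral_ge0 => x _; rewrite lee_fin.
have iKfin : (\int[leb]_(x in K) (g x)%:E)%E \is a fin_num.
  by rewrite ge0_fin_numE// (@le_lt_trans _ _ J%:E) ?ltry// split_int leeDl.
have iKCfin : (\int[leb]_(x in ~` K) (g x)%:E)%E \is a fin_num.
  by rewrite ge0_fin_numE// (@le_lt_trans _ _ J%:E) ?ltry// split_int leeDr.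
pose a := fine (\int[leb]_(x in K) (g x)%:E)%E.
pose b := fine (\int[leb]_(x in ~` K) (g x)%:E)%E.
have aE : (\int[leb]_(x in K) (g x)%:E = a%:E)%E by rewrite fineK.
have bE : (\int[leb]_(x in ~` K) (g x)%:E = b%:E)%E by rewrite fineK.
rewrite aE lte_fin in Jl.
have Jab : J = a + b by move: split_int; rewrite aE bE -EFinD => -[].
have b0 : 0 <= b by rewrite -lee_fin -bE.
(* [n * Q * e^(1+r) <= M] forces [e <= tau] once [n] exceeds [M / (Q * tau^(1+r))] *)
exists (Num.truncn (M / (Q * tau `^ (1 + r)))).+1 => n e F nN e0 eM cells.
have etau : e <= tau.
  rewrite leNgt; apply/negP => te.
  have Qt0 : 0 < Q * tau `^ (1 + r) by rewrite mulr_gt0// powR_gt0.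
  have : M < n%:R * (Q * tau `^ (1 + r)).
    rewrite -ltr_pdivrMr//; apply: lt_le_trans (_ : (Num.truncn (M / (Q * tau `^ (1 + r)))).+1%:R <= _).
      exact: truncnS_gt.
    by rewrite ler_nat.
  rewrite ltNge => /negP; apply; apply: le_trans eM.
  apply: ler_wpM2l => //; rewrite ler_pM2l//.
  by apply: ler_powRl; exact: ltW.
move: etau; rewrite le_min => /andP[mesh e8].
have low := integral_level_le r0 hdens hl AB lAB (ltW eps0) osc e0 cells mesh.
have upp := le_integral_level r0 hdens uni hl AB lAB (ltW eps0) osc e0 cells mesh gfin.
rewrite aE lee_fin in low.
rewrite aE bE -EFinM -!EFinD lee_fin -/k in upp.
rewrite ler_distl; apply/andP; split; last first.
  nra.
nra.
Unshelve. all: by end_near. Qed.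

End limit.

(** * Asymptotic optimality *)

Theorem theorem3p10 (R : realType) (r : R)
    (mu : probability (measurableTypeR R) R) (h : R -> R) (q : nat -> R -> R)
    (hr : 1 < r)
    (hdens : is_lebesgue_density mu h)
    (hunim : weakly_unimodal h)
    (hmoment : (\int[mu]_x (`|x| `^ r)%:E < +oo)%E)
    (hq : gersho_sequence mu r q)
    (hC0 : (C0 h r < +oo)%E) :
  asymptotically_optimal mu h r q.
Proof.
split=> [n n0|].
  by have [[_ [+ _ _ _]] _] := hq n n0; rewrite card_eq_le => /andP[].
have r0 : 0 < r by exact: lt_trans hr.
have r1 : 0 < 1 + r by rewrite addr_gt0.
pose Q : R := 2 `^ (- r) * (1 + r)^-1.
have Q0 : 0 < Q by rewrite mulr_gt0 ?invr_gt0// powR_gt0.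
pose Jbar := (\int[lebesgue_measure]_(x in [set: measurableTypeR R])
      (h x `^ (1 / (1 + r)))%:E)%E.
have Jbar0 : (0 <= Jbar)%E by apply: integral_ge0 => x _; rewrite lee_fin powR_ge0.
have Jfin : Jbar \is a fin_num.
  rewrite ge0_fin_numE// ltNge leye_eq; apply/negP => /eqP Jy.
  by move: hC0; rewrite /C0 -/Jbar Jy poweRyr ?gt_eqF// gt0_muley ?lte_fin// ltxx.
pose J := fine Jbar; have JE : Jbar = J%:E by rewrite fineK.
have J0 : 0 <= J by rewrite fine_ge0.
have mom0 : (0 <= \int[mu]_x (`|x| `^ r)%:E)%E.
  by apply: integral_ge0 => x _; rewrite lee_fin powR_ge0.
have momfin : (\int[mu]_x (`|x| `^ r)%:E)%E \is a fin_num by rewrite ge0_fin_numE.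
pose M := fine (\int[mu]_x (`|x| `^ r)%:E)%E.
pose e n := (n%:R^-1 * fine (distortion mu (q n) r) / Q) `^ (1 / (1 + r)).
have cells n : (0 < n)%N -> exists F : nat -> set (measurableTypeR R),
    [/\ distortion mu (q n) r = (n%:R * (Q * e n `^ (1 + r)))%:E,
      n%:R * (Q * e n `^ (1 + r)) <= M
    & equal_distortion_cells mu r n (Q * e n `^ (1 + r)) F].
  move=> n0; have [G _] := hq n n0.
  have [E [F [E0 DE EM cF]]] := gersho_equal_distortion_cells n0 G hmoment.
  have eE : Q * e n `^ (1 + r) = E.
    rewrite /e DE/= mulKf ?pnatr_eq0 -?lt0n// powRVr ?gt_eqF//; last first.
      by rewrite divr_ge0// ltW.
    by rewrite mulrC divfK// gt_eqF.
  by exists F; rewrite eE; split => //; rewrite -lee_fin fineK.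
have cvgJ : n%:R * e n @[n --> \oo] --> J.
  apply/cvgrPdist_le => eta eta0.
  have M0 : 0 <= M by rewrite fine_ge0.
  have [N HN] := normalized_cell_size_cvg r0 hdens hunim JE eta0 M0.
  exists N.+1 => // n /= Nn; have n0 : (0 < n)%N by exact: leq_trans Nn.
  have [F [_ eM cF]] := cells n n0.
  by apply: HN eM cF; [exact: ltnW|exact: powR_ge0].
rewrite /C0 -/Jbar JE poweR_EFin -/Q.
apply: (@cvg_trans _ ((Q * (`|n%:R * e n| `^ (1 + r)))%:E @[n --> \oo])).
  apply: near_eq_cvg; near=> n.
  have n0 : (0 < n)%N by near: n; exact: nbhs_infty_gt.
  have [F [-> _ _]] := cells n n0.
  rewrite -EFinM; congr EFin.
  rewrite ger0_norm ?mulr_ge0 ?powR_ge0// powRM ?powR_ge0// (@powRS _ n%:R)//.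
  by ring.
rewrite -EFinM; apply: cvg_EFin; first exact: nearW.
apply: cvgM; first exact: cvg_cst.
rewrite -[X in _ --> X `^ _]ger0_norm//.
exact: (continuous_cvg _ (@continuous_norm_powR R (1 + r) r1 J) cvgJ).
Unshelve. all: by end_near. Qed.
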